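(* Let $n\ge 1$ and $t\ge 2$ be integers. There exist infinitely many Salem numbers $\alpha$ of degree $2t$ such that $\alpha^{n}-1$ is a unit, whenever one of the following conditions holds: (i) $n$ is odd and $t\ge (n+3)/2$; (ii) $n\equiv 2 \pmod 4$, $t$ is odd and $t\ge (n+4)/2$; (iii) $n=2^{s}$ for some integer $s\ge 2$, $t$ is odd and $t\ge (n+6)/2$; (iv) $n\equiv 4 \pmod 8$, $n\not\equiv 0 \pmod 3$, $t$ is odd and $t\ge (n+6)/2$.
   Context: A Salem number is a real algebraic integer greater than $1$ whose other conjugates all lie in the closed unit disc, with at least one conjugate lying on the unit circle. Conjugates and degree are taken over $\mathbb{Q}$. A unit is an algebraic integer whose inverse is also an algebraic integer (equivalently, an algebraic integer of norm $\pm 1$ over $\mathbb{Q}$). *)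

(* Defs.v *)
From HB Require Import structures.
From mathcomp Require Import all_boot all_order all_algebra all_field.
From mathcomp Require Import classical_sets cardinality.

Set Implicit Arguments.
Unset Strict Implicit.
Unset Printing Implicit Defensive.

Import Order.TTheory GRing.Theory Num.Theory.
Local Open Scope ring_scope.

(* Every algebraic number lives in [algC], the field of complex algebraic
   numbers; [minCpoly a] is the minimal polynomial of [a] over the rationals, with
   its coefficients read in [algC], where it splits. *)
Definition conjugate (a b : algC) : bool := root (minCpoly a) b.

Definition alg_degree (a : algC) : nat := (size (minCpoly a)).-1.

(* [<=] on [algC] is a partial order comparing numbers with the same imaginary
   part, so [1 < a] already entails that [a] is real. *)
Definition salem (a : algC) : Prop :=
  [/\ a \in Aint, a \is Num.real, 1 < a,
      forall b : algC, conjugate a b -> b != a -> `|b| <= 1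
    & exists2 b : algC, conjugate a b & `|b| = 1].

(* [a != 0] is needed because [0^-1 = 0] is an algebraic integer. *)
Definition alg_unit (a : algC) : Prop :=
  [/\ a \in Aint, a != 0 & a^-1 \in Aint].

(* Main.v *)
(* Gross-McMullen's construction. Let [Q] be a monic integral polynomial of
   degree [t - 1] with distinct roots in [-2, 2], and [a] a large integer. The
   polynomial [R = Q * ('X - a) - 1] is a small perturbation of
   [Q * ('X - a)]: it has [t - 1] roots in the open interval ]-2, 2[ and one
   root [b > a]. At an end point [2] or [-2] that is a root of [Q], the sign of
   [Q] decides whether the perturbed root stays inside; for [-2] this is where
   the parity of [t] enters.
   For every root [c] of [R], [c - a] is a unit with inverse [Q.[c]]. If [b]
   were not a conjugate of [c], all conjugates of this unit would be larger than
   1 in absolute value, which is absurd. Hence [R] is irreducible, and the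
   solution [al > 1] of [al + al^-1 = b] is a Salem number of degree [2 * t].
   Since [Q.[b]] is a unit, so is every divisor of it among the algebraic
   integers; to make [al ^+ n - 1] one of them, up to a power of [al], it
   suffices that the roots of [Q] include all [w + w^-1] for [w ^+ n = 1]. The rest of
   [Q], of the prescribed degree, has roots [w + w^-1] for other roots of unity
   [w], and the arithmetic conditions on [n] make the two sets disjoint. *)
Require Import Defs.
From mathcomp Require Import all_boot all_order all_algebra all_field.
From mathcomp Require Import classical_sets cardinality.
From mathcomp Require Import ring lra zify.

Set Implicit Arguments.
Unset Strict Implicit.
Unset Printing Implicit Defensive.

Import Order.TTheory GRing.Theory Num.Theory.
Local Open Scope ring_scope.

(** * Roots of a perturbed product *)

Lemma seq_choice (T U : eqType) (P : T -> U -> Prop) (u0 : U) (s : seq T) :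
  {in s, forall x : T, exists y : U, P x y} ->
  exists f, {in s, forall x : T, P x (f x)}.
Proof.
elim: s => [|x s IHs] sP; first by exists (fun=> u0).
have [y ys|f fP] := IHs; first by apply: sP; rewrite inE ys orbT.
have [y Pxy] := sP x (mem_head _ _).
exists (fun z => if z == x then y else f z) => z.
by rewrite inE; case: eqP => [->|_] //= /fP.
Qed.

Section RealRoots.
Variable F : rcfType.
Implicit Types (s : seq F) (e r x y a : F) (p : {poly F}).

Lemma seq_lower_bound s :
  {in s, forall x, 0 < x} -> exists2 e, 0 < e & {in s, forall x, e < x}.
Proof.
elim: s => [|x s IHs] s_gt0; first by exists 1.
have [y ys|e e_gt0 ltes] := IHs; first by apply: s_gt0; rewrite inE ys orbT.
have x_gt0 : 0 < x by apply: s_gt0; rewrite mem_head.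
exists (Num.min (x / 2) e); first by rewrite lt_min e_gt0 divr_gt0.
move=> y; rewrite inE gt_min => /predU1P[->|/ltes->]; last by rewrite orbT.
by apply/orP; left; lra.
Qed.

(** The product form leaves open which end is negative, and it excludes roots at the ends, so the
    interval can be strict. *)
Lemma poly_ivt_lt0 p x y :
  x < y -> p.[x] * p.[y] < 0 -> exists2 z, x < z < y & root p z.
Proof.
move=> ltxy; wlog px_lt0 : p / p.[x] < 0 => [IH|] pxy_lt0.
  have [px_lt0|px_ge0] := ltP p.[x] 0; first exact: IH.
  have px_gt0 : 0 < p.[x].
    rewrite lt_def px_ge0 andbT; apply: contraTneq pxy_lt0 => ->.
    by rewrite mul0r ltxx.
  have [||z zxy] := IH (- p); rewrite ?hornerN ?oppr_lt0 ?mulrNN //.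
  by rewrite rootN; exists z.
have py_gt0 : 0 < p.[y] by rewrite nmulr_rlt0 in pxy_lt0.
have [||z /andP[lexz lezy] rz] := @poly_ivt F p x y; rewrite ?ltW ?px_lt0 //.
exists z => //; rewrite !lt_def lexz lezy !andbT.
apply/andP; split; apply: contraTneq rz => eqz.
  by rewrite eqz rootE lt_eqF.
by rewrite -eqz rootE gt_eqF.
Qed.

Lemma prodr_lt0_sign (s : seq F) (f : F -> F) :
  {in s, forall r, f r < 0} -> 0 < (-1) ^+ size s * \prod_(r <- s) f r.
Proof.
elim: s => [|x s IHs] f_lt0; first by rewrite big_nil mul1r ltr01.
rewrite big_cons /= exprS mulN1r mulNr mulrCA -mulNr mulr_gt0 ?oppr_gt0 //.
  by rewrite f_lt0 ?mem_head.
by apply: IHs => y ys; rewrite f_lt0 ?inE ?ys ?orbT.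
Qed.

Lemma prodr_gt0_in (s : seq F) (f : F -> F) :
  {in s, forall r, 0 < f r} -> 0 < \prod_(r <- s) f r.
Proof. by move=> f_gt0; rewrite big_seq prodr_gt0. Qed.

Lemma horner_prod_XsubC s x :
  (\prod_(r <- s) ('X - r%:P)).[x] = \prod_(r <- s) (x - r).
Proof. by rewrite horner_prod; apply: eq_bigr => r _; rewrite hornerXsubC. Qed.

Lemma perturbed_roots s :
    uniq s -> {in s, forall r, -2 <= r <= 2} -> 2 \in s ->
    (-2 \in s -> ~~ odd (size s)) ->
  exists A, forall a, A <= a -> exists bs b,
    [/\ \prod_(r <- s) ('X - r%:P) * ('X - a%:P) - 1
          = ('X - b%:P) * \prod_(c <- bs) ('X - c%:P),
        size bs = size s, {in bs, forall c, -2 < c < 2}, uniq bs & a < b].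
Proof.
move=> s_uniq s_bnd s2 sN2.
set Q := \prod_(r <- s) _.
(* The radius [e] lies below half of every gap between roots and below every nonzero distance to an
   end point; the extra 1 keeps [r + e] below 3. *)
pose gaps := [seq `|r - r'| / 2 | r <- s, r' <- s] ++
  [seq 2 - r | r <- s] ++ [seq r + 2 | r <- s].
have [x|e e_gt0 e_lt] := @seq_lower_bound (1 :: [seq x <- gaps | 0 < x]).
  by rewrite inE mem_filter => /predU1P[->|/andP[]//]; rewrite ltr01.
have e_lt1 : e < 1 by apply: e_lt; rewrite mem_head.
have {}e_lt x : x \in gaps -> 0 < x -> e < x.
  by move=> xg x0; apply: e_lt; rewrite inE mem_filter x0 xg orbT.
have e_gap r r' : r \in s -> r' \in s -> r != r' -> 2 * e < `|r - r'|.
  move=> rs r's neq_rr'; have d_gt0 : 0 < `|r - r'| by rewrite normr_gt0 subr_eq0.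
  suff: e < `|r - r'| / 2 by lra.
  apply: e_lt; last by lra.
  by rewrite !mem_cat; apply/orP; left; apply/allpairsP; exists (r, r').
have e_lt2 r : r \in s -> r != 2 -> e < 2 - r.
  move=> rs r2; apply: e_lt.
    by rewrite !mem_cat; apply/or3P; apply: Or32; apply: map_f.
  by rewrite subr_gt0 lt_def eq_sym r2; case/andP: (s_bnd r rs).
have e_ltN2 r : r \in s -> r != -2 -> e < r + 2.
  move=> rs r2; apply: e_lt.
    rewrite !mem_cat; apply/or3P; apply: Or33.
    exact: (map_f (fun r => r + 2)).
  by rewrite -[2]opprK subr_gt0 lt_def r2; case/andP: (s_bnd r rs).
(* Only the factor at [r] changes sign across [r]: every other factor contributes
   [(r - r') ^+ 2 - e ^+ 2 > 0]. *)
have Q_lt0 r : r \in s -> Q.[r - e] * Q.[r + e] < 0.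
  move=> rs; rewrite !horner_prod_XsubC -big_split /= (big_rem r) //=.
  rewrite pmulr_llt0; first by rewrite addrAC subrr; nra.
  apply: prodr_gt0_in => r'; rewrite mem_rem_uniq // inE => /andP[ne_r'r r's].
  have := e_gap _ _ rs r's; rewrite eq_sym => /(_ ne_r'r) gap.
  suff : 0 < `|r - r'| ^+ 2 - e ^+ 2 by rewrite real_normK ?num_real //; nra.
  by nra.
have Q2 : Q.[2 - e] < 0.
  rewrite horner_prod_XsubC (big_rem 2) //= pmulr_llt0; first by lra.
  apply: prodr_gt0_in => r'; rewrite mem_rem_uniq // inE => /andP[ne_r'r r's].
  by have := e_lt2 _ r's ne_r'r; lra.
(* Just right of -2 the factor at -2 is positive and the others are negative; their number
   [(size s).-1] is odd. *)
have QN2 : -2 \in s -> Q.[-2 + e] < 0.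
  move=> sN2s; rewrite horner_prod_XsubC (big_rem (-2)) //=.
  rewrite pmulr_rlt0; last by lra.
  have := @prodr_lt0_sign (rem (-2) s) (fun r => -2 + e - r).
  rewrite size_rem // -signr_odd.
  have -> : odd (size s).-1.
    by have := sN2 sN2s; case: (s) sN2s => //= x s' _; rewrite negbK.
  rewrite expr1 mulN1r oppr_gt0; apply => r'.
  rewrite mem_rem_uniq // inE => /andP[ne_r'r r's].
  by have := e_ltN2 _ r's ne_r'r; lra.
pose vals := [seq `|Q.[r - e]| | r <- s] ++ [seq `|Q.[r + e]| | r <- s].
have [x|d d_gt0 d_lt] := @seq_lower_bound [seq x <- vals | 0 < x].
  by rewrite mem_filter => /andP[].
have {}d_lt x : x \in vals -> 0 < x -> d < x.
  by move=> xg x0; apply: d_lt; rewrite mem_filter x0 xg.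
have d_Q r : r \in s -> d < `|Q.[r - e]| /\ d < `|Q.[r + e]|.
  move=> rs; have Qrs := Q_lt0 r rs.
  split; apply: d_lt.
  - by rewrite mem_cat; apply/orP; left; apply/mapP; exists r.
  - by rewrite normr_gt0; apply: contraTneq Qrs => ->; rewrite mul0r ltxx.
  - by rewrite mem_cat; apply/orP; right; apply/mapP; exists r.
  - by rewrite normr_gt0; apply: contraTneq Qrs => ->; rewrite mulr0 ltxx.
(* For [x <= 3] this gives [d * (a - x) >= 1], so where [|Q|] exceeds [d] the term -1 cannot
   outweigh [Q * ('X - a)], and [R] has the sign opposite to [Q]. *)
exists (d^-1 + 3) => a le_a.
have dV_gt0 : 0 < d^-1 by rewrite invr_gt0.
pose R := Q * ('X - a%:P) - 1.
have RE x : R.[x] = Q.[x] * (x - a) - 1 by rewrite !hornerE.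
have Rsign x : x <= 3 -> d < `|Q.[x]| -> Q.[x] * R.[x] < 0.
  move=> x3 dx; rewrite RE; have da : d * (a - x) >= 1.
    have: d * d^-1 = 1 by rewrite divff // gt_eqF.
    by nra.
  have [Qx_ge0|Qx_lt0] := leP 0 Q.[x].
    by rewrite ger0_norm // in dx; nra.
  rewrite ltr0_norm // in dx.
  by have : 1 < (- Q.[x]) * (a - x); nra.
have R_root r : r \in s -> exists z, [&& `|z - r| < e, -2 < z < 2 & root R z].
  move=> rs; have /andP[rN2 r2] := s_bnd r rs; have [dm dp] := d_Q r rs.
  have Rm : Q.[r - e] * R.[r - e] < 0 by apply: Rsign => //; lra.
  have Rp : Q.[r + e] * R.[r + e] < 0 by apply: Rsign => //; lra.
  have Qr0 : Q.[r] = 0 by apply/rootP; rewrite root_prod_XsubC.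
  have Rr : R.[r] = -1 by rewrite RE Qr0; ring.
  (* At an end point only the inner side is available: [R] is -1 at the end point itself and
     positive at distance [e] inside. *)
  have [r2E|r2'] := eqVneq r 2.
    have [||z zI rz] := @poly_ivt_lt0 R (2 - e) 2; first by lra.
      by move: Rm Rr; rewrite r2E => Rm ->; nra.
    exists z; rewrite rz andbT r2E ltr_norml.
    apply/andP; split; [apply/andP; split|apply/andP; split]; lra.
  have [rN2E|rN2'] := eqVneq r (-2).
    have [||z zI rz] := @poly_ivt_lt0 R (-2) (-2 + e); first by lra.
      have := QN2; rewrite -rN2E => /(_ rs).
      by move: Rp Rr; rewrite rN2E => Rp ->; nra.
    exists z; rewrite rz andbT rN2E ltr_norml.
    apply/andP; split; [apply/andP; split|apply/andP; split]; lra.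
  have := e_lt2 _ rs r2'; have := e_ltN2 _ rs rN2' => eN e2.
  have [||z zI rz] := @poly_ivt_lt0 R (r - e) (r + e); first by lra.
    have : 0 < (Q.[r - e] * Q.[r + e]) * (R.[r - e] * R.[r + e]).
      by rewrite mulrACA nmulr_rgt0.
    by rewrite nmulr_rgt0 ?Q_lt0.
  exists z; rewrite rz andbT ltr_norml.
  apply/andP; split; [apply/andP; split|apply/andP; split]; lra.
have [f fP] := seq_choice 0 R_root.
(* [R.[a] = -1], while [R.[a + 1] = Q.[a + 1] - 1] is positive: the root 2 of [Q] gives a factor
   [a - 1 > 1], and the other factors are at least 1. *)
have [||b bI rb] := @poly_ivt_lt0 R a (a + 1); first by lra.
  rewrite !RE subrr mulr0 sub0r mulN1r oppr_lt0 addrAC subrr add0r mulr1.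
  rewrite subr_gt0 horner_prod_XsubC (big_rem 2) //=.
  have : 1 <= \prod_(y <- rem 2 s) (a + 1 - y).
    rewrite big_seq; elim/big_ind: _ => // [x y x1 y1|y]; first by nra.
    by move=> /mem_rem /s_bnd; lra.
  by nra.
have bs_bnd c : c \in map f s -> -2 < c < 2.
  by case/mapP=> r /fP/and3P[_ H _] ->.
have bs_uniq : uniq (map f s).
  rewrite map_inj_in_uniq // => r r' rs r's eqf; apply/eqP; apply: contraT => ne.
  have /and3P[+ _ _] := fP _ rs; have /and3P[+ _ _] := fP _ r's.
  rewrite eqf ltr_norml => H1; rewrite ltr_norml => H2.
  by have := e_gap _ _ rs r's ne; rewrite lter_normr; lra.
exists (map f s), b; split=> //; last by case/andP: bI.
  transitivity (\prod_(c <- b :: map f s) ('X - c%:P)); last by rewrite big_cons.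
  have szR : size (Q * ('X - a%:P)) = (size s).+2.
    by rewrite size_mul ?monic_neq0 ?monicXsubC ?monic_prod_XsubC //
      size_prod_XsubC size_XsubC addn2.
  have R_mon : R \is monic.
    rewrite monicE lead_coefDl ?szR ?size_polyN ?size_poly1 //.
    by rewrite lead_coefM lead_coefXsubC mulr1 (monicP (monic_prod_XsubC _ _ _)).
  have R_size : size R = (size s).+2.
    by rewrite size_polyDl szR // size_polyN size_poly1.
  rewrite -/R [LHS](@all_roots_prod_XsubC _ _ (b :: map f s)).
  - by rewrite (monicP R_mon) scale1r.
  - by rewrite R_size /= size_map.
  - rewrite /= rb; apply/allP => _ /mapP[r rs ->].
    by case/and3P: (fP _ rs).
  - rewrite uniq_rootsE /= bs_uniq andbT; apply/negP => /bs_bnd.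
    by lra.
by rewrite size_map.
Qed.
End RealRoots.

(** * Algebraic integers and their conjugates *)

Implicit Types (p q : {poly algC}) (x y z a b : algC).

Lemma minCpoly_Crat x : minCpoly x \is a polyOver Crat.
Proof.
have [p [-> _] _] := minCpolyP x.
by apply/polyOverP => i; rewrite coef_map Crat_rat.
Qed.

Lemma polyOver_CratP p :
  p \is a polyOver Crat -> exists q : {poly rat}, p = map_poly ratr q.
Proof.
move/polyOverP => pC; exists (\poly_(i < size p) getCrat p`_i).
apply/polyP => i; rewrite coef_map coef_poly.
by case: ltnP => [_|le]; [rewrite /= getCratK | rewrite nth_default // raddf0].
Qed.

Lemma minCpoly_factor q x : q \is a polyOver Crat -> root q x ->
  exists2 h, h \is a polyOver Crat & q = h * minCpoly x.
Proof.
case/polyOver_CratP => r ->; have [p [-> _] ->] := minCpolyP x.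
case/dvdpP => h ->; exists (map_poly ratr h); last by rewrite rmorphM.
by apply/polyOverP => i; rewrite coef_map Crat_rat.
Qed.

Lemma dvd_minCpoly q x :
  q \is a polyOver Crat -> root q x -> minCpoly x %| q.
Proof. by move=> qC /(minCpoly_factor qC)[h _ ->]; exact: dvdp_mull. Qed.

Lemma conj_root q x y :
  q \is a polyOver Crat -> root q x -> root (minCpoly x) y -> root q y.
Proof. by move=> qC /(minCpoly_factor qC)[h _ ->] yx; rewrite rootM yx orbT. Qed.

(** A rational algebraic integer is an integer, so integral coefficients can be tracked as
    membership in the two subrings [Crat] and [Aint]. *)
Lemma root_monic_AintC p x : root p x -> p \is monic ->
  p \is a polyOver Crat -> p \is a polyOver Aint -> x \in Aint.
Proof.
move=> px p_mon /polyOverP pC /polyOverP pA; apply: root_monic_Aint px p_mon _.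
by apply/polyOverP => i; apply: Cint_rat_Aint.
Qed.

Lemma polyOver_MXaddC (S : addrClosed algC) p a :
  p * 'X + a%:P \is a polyOver S -> p \is a polyOver S /\ a \in S.
Proof.
move=> /polyOverP pS; split; last first.
  by have := pS 0%N; rewrite coefD coefMX coefC add0r.
by apply/polyOverP => i; have := pS i.+1; rewrite coefD coefMX coefC addr0.
Qed.

(** Otherwise dividing by ['X] would leave a rational polynomial of smaller degree that still
    vanishes at [x]. *)
Lemma minCpoly_root0 x : x != 0 -> ~~ root (minCpoly x) 0.
Proof.
move=> x0; apply/negP => /factor_theorem[h].
rewrite subr0 => mE; have := minCpoly_Crat x.
rewrite mE -[_ * _]addr0 -polyC0 => /polyOver_MXaddC[hC _].
have hx : root h x.
  by have := root_minCpoly x; rewrite mE rootM rootX (negPf x0) orbF.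
have h0 : h != 0.
  apply: contraTneq (minCpoly_monic x) => h0.
  by rewrite mE h0 mul0r monicE lead_coef0 eq_sym oner_eq0.
by have := dvdp_leq h0 (dvd_minCpoly hC hx); rewrite mE size_mulX // ltnn.
Qed.

(** The constant term of the minimal polynomial is a nonzero integer, and its absolute value is the
    product of those of the conjugates; one factor below 1 forces another above 1. *)
Lemma Aint_conj_gt1 x : x \in Aint -> x != 0 -> `|x| < 1 ->
  exists2 c, root (minCpoly x) c & 1 < `|c|.
Proof.
move=> Zx x0 x_lt1; have [cs Dp] := closed_field_poly_normal (minCpoly x).
rewrite (monicP (minCpoly_monic x)) scale1r in Dp.
have rootE c : root (minCpoly x) c = (c \in cs) by rewrite Dp root_prod_XsubC.
have [|/hasPn le1] := boolP (has (fun c => 1 < `|c|) cs).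
  by case/hasP => c ccs; exists c => //; rewrite rootE.
have xcs : x \in cs by rewrite -rootE root_minCpoly.
have p0 : `|(minCpoly x).[0]| = \prod_(c <- cs) `|c|.
  rewrite Dp horner_prod normr_prod; apply: eq_bigr => c _.
  by rewrite hornerXsubC sub0r normrN.
have lt1 : \prod_(c <- cs) `|c| < 1.
  rewrite (big_rem x) //=; apply: le_lt_trans x_lt1.
  rewrite ler_piMr // big_seq; apply: prodr_ile1 => c /mem_rem ccs.
  by rewrite normr_ge0 real_leNgt ?le1 ?normr_real ?rpred1.
have : 1 <= `|(minCpoly x).[0]|.
  apply: norm_intr_ge1; last exact: minCpoly_root0.
  by rewrite rpred_horner ?rpred0 //; exact: Zx.
by rewrite p0 => /le_lt_trans/(_ lt1); rewrite ltxx.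
Qed.

(* [p] is reduced to [A + x * B] modulo [x ^+ 2 - y * x + 1], with [A] and [B]
   polynomials in [y = x + x^-1]. *)
Lemma mul_inv_eval p : p \is a polyOver Crat ->
  exists2 q, q \is a polyOver Crat &
    forall x, x != 0 -> q.[x + x^-1] = p.[x] * p.[x^-1].
Proof.
move=> pC; suff [A [B [CA CB pE]]] : exists A B,
    [/\ A \is a polyOver Crat, B \is a polyOver Crat &
        forall x, x != 0 -> p.[x] = A.[x + x^-1] + x * B.[x + x^-1]].
  exists (A ^+ 2 + 'X * A * B + B ^+ 2).
    by rewrite !rpredD ?rpredM ?rpredX ?polyOverX.
  move=> x x0; rewrite pE // (pE x^-1) ?invr_eq0 // invrK (addrC x^-1).
  by rewrite !hornerE; field.
elim/poly_ind: p pC => [_|p c IHp /polyOver_MXaddC[/IHp[A [B [CA CB pE]]] cC]].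
  by exists 0, 0; rewrite rpred0; split=> // x _; rewrite !horner0 mulr0 addr0.
exists (c%:P - B), (A + 'X * B).
split; rewrite ?rpredB ?rpredD ?rpredM ?polyOverC ?polyOverX //.
by move=> x x0; rewrite !hornerE pE //; field.
Qed.

(** Translating by [a] and reversing the coefficients turns a rational equation for [a + x^-1] into
    one for [x]. *)
Lemma inv_shift_eval p a : p \is a polyOver Crat -> a \in Crat ->
  exists2 q, q \is a polyOver Crat &
    exists k, forall x, x != 0 -> q.[x] = x ^+ k * p.[a + x^-1].
Proof.
move=> pC aC; elim/poly_ind: p pC => [_|p c IHp /polyOver_MXaddC[/IHp[q qC [k qE]] cC]].
  by exists 0; rewrite ?rpred0 //; exists 0%N => x _; rewrite !horner0 mulr0.
exists (q * (a *: 'X + 1) + c *: 'X^(k.+1)).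
  by rewrite rpredD ?rpredM ?rpredD ?polyOverZ ?rpredX ?polyOverX ?rpred1.
by exists k.+1 => x x0; rewrite !hornerE qE // !exprS; field.
Qed.

Lemma eq_poly_neq0 p q : (forall x, x != 0 -> p.[x] = q.[x]) -> p = q.
Proof.
move=> eq_pq; apply/eqP; rewrite -subr_eq0; apply: contraT => pq0.
pose s := [seq i.+1%:R : algC | i <- iota 0 (size (p - q))].
have := @max_poly_roots _ _ s pq0; rewrite size_map size_iota ltnn; apply.
  by apply/allP => _ /mapP[i _ ->]; rewrite rootE !hornerE eq_pq ?subrr ?pnatr_eq0.
by rewrite map_inj_uniq ?iota_uniq // => i j /eqP; rewrite eqr_nat eqSS => /eqP.
Qed.

Lemma trace_lift_eval (s : seq algC) x : x != 0 ->
  (\prod_(b <- s) ('X^2 - b *: 'X + 1)).[x] =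
    x ^+ size s * (\prod_(b <- s) ('X - b%:P)).[x + x^-1].
Proof.
move=> x0; elim: s => [|b s IHs]; first by rewrite !big_nil !hornerE.
rewrite !big_cons !hornerM IHs /= exprS; set P := horner (\prod_(_ <- _) _) _.
by rewrite !hornerE /= exprS; field.
Qed.

(** The single roots [b] need not lie in [S], so the lift is rebuilt from the coefficients of the
    whole product by Horner's scheme, where multiplying by [x + x^-1] and by one more [x] gives the
    factor ['X^2 + 1]. *)
Lemma trace_lift_polyOver (S : subringClosed algC) (s : seq algC) :
    \prod_(b <- s) ('X - b%:P) \is a polyOver S ->
  \prod_(b <- s) ('X^2 - b *: 'X + 1) \is a polyOver S.
Proof.
pose R := \prod_(b <- s) ('X - b%:P).
suff H p k : p \is a polyOver S -> (size p <= k.+1)%N ->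
    exists2 q, q \is a polyOver S &
      forall x, x != 0 -> q.[x] = x ^+ k * p.[x + x^-1].
  move=> RZ; have [|q qZ qE] := H R (size s) RZ; first by rewrite size_prod_XsubC.
  suff -> : \prod_(b <- s) ('X^2 - b *: 'X + 1) = q by [].
  by apply: eq_poly_neq0 => x x0; rewrite qE // trace_lift_eval.
elim/poly_ind: p k => [|p c IHp] k.
  by exists 0; rewrite ?rpred0 // => x _; rewrite !horner0 mulr0.
move=> /polyOver_MXaddC[pZ cZ].
have [-> _|p0] := eqVneq p 0.
  exists (c *: 'X^k); first by rewrite polyOverZ ?rpredX ?polyOverX.
  by move=> x x0; rewrite !hornerE /= mulrC.
rewrite size_MXaddC (negPf p0) /=.
case: k => [|k]; first by rewrite ltnS leqn0 size_poly_eq0 (negPf p0).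
rewrite ltnS => /(IHp _ pZ)[q qZ qE].
exists (q * ('X^2 + 1) + c *: 'X^(k.+1)).
  by rewrite rpredD ?rpredM ?rpredD ?polyOverZ ?rpredX ?polyOverX ?rpred1.
by move=> x x0; rewrite !hornerE qE // !exprS; field.
Qed.

(** Comparing the trace with its complex conjugate shows that [x] is real or of modulus 1; a real
    [x] has [(x + x^-1) ^+ 2 = (x - x^-1) ^+ 2 + 4 >= 4]. *)
Lemma unit_circle_trace x : x != 0 -> x + x^-1 \is Num.real ->
  `|x + x^-1| < 2 -> `|x| = 1.
Proof.
set c := x + x^-1 => x0 cR c2.
have xc : x ^+ 2 - c * x + 1 = 0 by rewrite /c; field.
have xJ0 : x^* != 0 by rewrite conjC_eq0.
have : (x^* - x) * (x^* * x - 1) = 0.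
  have cE : x^* + (x^*)^-1 = c.
    by rewrite -(CrealP cR) /c rmorphD /= fmorphV.
  have -> : (x^* - x) * (x^* * x - 1) = x^* * x * ((x^* + (x^*)^-1) - (x + x^-1)).
    by field; rewrite x0.
  by rewrite cE subrr mulr0.
move/eqP; rewrite mulf_eq0 !subr_eq0 => /orP[/eqP/CrealP xR|/eqP xx].
  have d_ge0 : 0 <= (x - x^-1) ^+ 2 by rewrite real_exprn_even_ge0 ?rpredB ?rpredV.
  have : `|c| ^+ 2 < 2 ^+ 2 by rewrite ltrXn2r.
  have -> : `|c| ^+ 2 = (x - x^-1) ^+ 2 + 2 ^+ 2.
    by rewrite real_normK // /c; field.
  rewrite -subr_gt0 opprD addrCA subrr addr0 oppr_gt0.
  by move=> /(le_lt_trans d_ge0); rewrite ltxx.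
by apply/eqP; rewrite -(@pexpr_eq1 _ _ 2) // normCK mulrC xx.
Qed.

Lemma quad_size c : size ('X^2 - c *: 'X + 1 : {poly algC}) = 3.
Proof.
rewrite -addrA size_polyDl ?size_polyXn //.
rewrite (leq_ltn_trans (size_polyD _ _)) // gtn_max size_polyN size_poly1 andbT.
by rewrite (leq_ltn_trans (size_scale_leq _ _)) ?size_polyX.
Qed.

Lemma quad_monic c : ('X^2 - c *: 'X + 1 : {poly algC}) \is monic.
Proof.
by rewrite monicE lead_coefE quad_size !coefE /= mulr0 subr0 addr0.
Qed.

(** * The Salem number attached to a perturbed trace polynomial *)

Section SalemTrace.

Variables (Q : {poly algC}) (a : algC) (bs : seq algC) (b al : algC).
Hypotheses (QC : Q \is a polyOver Crat) (QA : Q \is a polyOver Aint).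
Hypotheses (aC : a \in Crat) (aA : a \in Aint) (a_ge3 : 3 <= `|a|).
Hypothesis RE :
  Q * ('X - a%:P) - 1 = ('X - b%:P) * \prod_(c <- bs) ('X - c%:P).
Hypothesis bsP : {in bs, forall c, c \is Num.real /\ `|c| < 2}.
Hypotheses (al_gt1 : 1 < al) (alE : al + al^-1 = b).

Let R := \prod_(c <- b :: bs) ('X - c%:P).
Let S := \prod_(c <- b :: bs) ('X^2 - c *: 'X + 1).

Let R_def : R = Q * ('X - a%:P) - 1.
Proof. by rewrite RE /R big_cons. Qed.

Let RC : R \is a polyOver Crat.
Proof. by rewrite R_def rpredB ?rpredM ?rpred1 ?polyOverXsubC. Qed.

Let RA : R \is a polyOver Aint.
Proof. by rewrite R_def rpredB ?rpredM ?rpred1 ?polyOverXsubC. Qed.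

Let rootR c : root R c = (c \in b :: bs).
Proof. by rewrite root_prod_XsubC. Qed.

Let RQ c : c \in b :: bs -> Q.[c] * (c - a) = 1.
Proof.
by rewrite -rootR R_def rootE !hornerE subr_eq0 => /eqP.
Qed.

Let trace_Aint c : c \in b :: bs -> c \in Aint.
Proof.
by rewrite -rootR => /root_monic_AintC; apply => //; apply: monic_prod_XsubC.
Qed.

Let gt1_dist c : c \in bs -> 1 < `|c - a|.
Proof.
case/bsP => _ c2; rewrite distrC; apply: lt_le_trans (lerB_dist _ _).
rewrite ltrBrDr (lt_le_trans _ a_ge3) //.
by rewrite (_ : 3 = 1 + 2) ?ltrD2l // -natrD.
Qed.

(* Over [bs], [Q.[c] = (c - a)^-1] is an algebraic integer of modulus less than
   1, so its conjugates cannot all come from [bs]. *)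
Lemma root_trace_max f c : f \is a polyOver Crat ->
  c \in b :: bs -> root f c -> root f b.
Proof.
move=> fC; rewrite inE => /predU1P[-> //|cbs] fc.
have cR : c \in b :: bs by rewrite inE cbs orbT.
pose v := Q.[c]; have vE : v * (c - a) = 1 by apply: RQ.
have v0 : v != 0 by apply: contra_eq_neq vE => ->; rewrite mul0r eq_sym oner_eq0.
have vV : v^-1 = c - a by apply: (mulfI v0); rewrite vE divff.
have vA : v \in Aint by rewrite rpred_horner ?trace_Aint.
have v_lt1 : `|v| < 1.
  by rewrite -[v]invrK vV normfV invf_lt1 ?(lt_trans ltr01) ?gt1_dist.
have [w wv w_gt1] := Aint_conj_gt1 vA v0 v_lt1.
have w0 : w != 0 by rewrite -normr_gt0 (lt_trans ltr01).
(* Since [c = a + v^-1], a rational equation for [c] yields one for [v], which the conjugate [w] of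
   [v] satisfies too. *)
have w_root g : g \is a polyOver Crat -> root g c -> root g (a + w^-1).
  move=> gC gc; have [q qC [k qE]] := inv_shift_eval gC aC.
  have : root q w.
    by apply: conj_root wv => //; rewrite rootE qE // vV addrC subrK (rootP gc) mulr0.
  by rewrite rootE qE // mulf_eq0 expf_eq0 (negPf w0) andbF.
(* This root of [R] is at distance less than 1 from [a], which singles out [b]. *)
have : root R (a + w^-1) by apply: w_root => //; rewrite rootR.
rewrite rootR inE => /predU1P[<-|/gt1_dist]; first exact: w_root.
rewrite addrAC subrr add0r normfV invf_gt1 ?normr_gt0 //.
by move/(lt_trans w_gt1); rewrite ltxx.
Qed.

Let al_gt0 : 0 < al. Proof. exact: lt_trans al_gt1. Qed.
Let al_neq0 : al != 0. Proof. by rewrite gt_eqF. Qed.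

Let rootS x : root S x = (x != 0) && (x + x^-1 \in b :: bs).
Proof.
have [->|x0] := eqVneq x 0.
  rewrite rootE /S horner_prod big1 ?oner_eq0 // => c _.
  by rewrite !hornerE /=; ring.
by rewrite rootE trace_lift_eval // mulf_eq0 expf_eq0 (negPf x0) andbF -rootR.
Qed.

Let rootS_norm x : root S x -> [|| x == al, x == al^-1 | `|x| == 1].
Proof.
rewrite rootS inE => /andP[x0 /orP[/eqP xb|/bsP[cR c2]]].
  have : (x - al) * (x - al^-1) = x * ((x + x^-1) - (al + al^-1)).
    by field; rewrite ?x0 ?al_neq0.
  rewrite xb alE subrr mulr0 => /eqP; rewrite mulf_eq0 !subr_eq0.
  by case/orP => ->; rewrite ?orbT.
by rewrite (unit_circle_trace x0) // eqxx !orbT.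
Qed.

Let rootS_al : root S al /\ root S al^-1.
Proof. by rewrite !rootS invr_eq0 invrK al_neq0 (addrC al^-1) alE mem_head. Qed.

Let S_monic : S \is monic.
Proof. by apply: monic_prod => c _; rewrite quad_monic. Qed.

Let size_S : size S = (2 * (size bs).+1).+1.
Proof.
rewrite /S -[(size bs).+1]/(size (b :: bs)); elim: (b :: bs) => [|c s IHs].
  by rewrite big_nil size_poly1.
rewrite big_cons size_monicM ?quad_monic ?quad_size //; last first.
  by apply/monic_neq0/monic_prod => d _; rewrite quad_monic.
by rewrite IHs /= addnS mulnS.
Qed.

Let SC : S \is a polyOver Crat. Proof. exact: trace_lift_polyOver. Qed.
Let SA : S \is a polyOver Aint. Proof. exact: trace_lift_polyOver. Qed.

Lemma salem_Aint : al \in Aint /\ al^-1 \in Aint.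
Proof.
by split; apply: (@root_monic_AintC S) => //; case: rootS_al.
Qed.

(** The product [p.[x] * p.[x^-1]] is a rational polynomial in the trace, so its vanishing passes to
    [b], and [p] kills [al] or [al^-1]. In the second case [al^-1], of modulus below 1, has a
    conjugate of modulus above 1, and [al] is the only such root of [S]. *)
Let root_S_al p x : p \is a polyOver Crat -> root S x -> root p x -> root p al.
Proof.
move=> pC; rewrite rootS => /andP[x0 xbs] px.
have [q qC qE] := mul_inv_eval pC.
have : root q b.
  by apply: root_trace_max xbs _ => //; rewrite rootE qE // (rootP px) mul0r.
rewrite -alE rootE qE // mulf_eq0 => /orP[//|pV].
have [_ alVA] := salem_Aint.
have [||w wv w_gt1] := Aint_conj_gt1 alVA; rewrite ?invr_eq0 //.
  by rewrite normfV invf_lt1 ?gtr0_norm // normr_gt0.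
have Sw : root S w by apply: conj_root wv => //; case: rootS_al.
suff <- : w = al by apply: conj_root wv.
have /or3P[/eqP //|/eqP wE|/eqP wE] := rootS_norm Sw.
  move: w_gt1; rewrite wE normfV gtr0_norm // invf_gt1 // => /(lt_trans al_gt1).
  by rewrite ltxx.
by rewrite wE ltxx in w_gt1.
Qed.

(** A nonconstant cofactor of the minimal polynomial in [S] would also vanish at [al], but [al] is a
    simple root of [S]. *)
Lemma minCpoly_salem : minCpoly al = S.
Proof.
have [Sal _] := rootS_al.
have [h hC Sh] := minCpoly_factor SC Sal.
have h_mon : h \is monic by rewrite -(monicMr _ (minCpoly_monic al)) -Sh.
suff szh : size h = 1%N.
  move: Sh h_mon; rewrite (size1_polyC (eq_leq szh)) => ->.
  by rewrite monicE lead_coefC => /eqP ->; rewrite mul1r.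
apply/eqP; apply: contraT => /closed_rootP[w hw].
have Sw : root S w by rewrite Sh rootM hw.
have := root_S_al hC Sw hw; have := root_minCpoly al.
move=> /factor_theorem[g gE] /factor_theorem[k kE].
pose T := ('X - al^-1%:P) * \prod_(c <- bs) ('X^2 - c *: 'X + 1).
have ST : S = T * ('X - al%:P).
  rewrite /S big_cons /T mulrAC; congr (_ * _).
  apply: eq_poly_neq0 => x x0; rewrite !hornerE /= -alE.
  by field.
have TE : T = k * g * ('X - al%:P).
  apply: (mulIf (_ : ('X - al%:P) != 0)); first by rewrite polyXsubC_eq0.
  by rewrite -ST Sh gE kE; ring.
have : root T al by rewrite TE rootM root_XsubC eqxx orbT.
(* A second factor vanishing at [al] means either [al = al^-1], or [b] in [bs] and then [al] on the
   unit circle; both contradict [al > 1]. *)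
rewrite rootM root_XsubC => /orP[/eqP alV|].
  have : al * al = 1 by rewrite [X in X * _]alV mulVf.
  by move/eqP; rewrite -expr2 pexpr_eq1 ?ltW // gt_eqF.
rewrite rootE trace_lift_eval // alE mulf_eq0 expf_eq0 (negPf al_neq0) andbF.
rewrite -rootE root_prod_XsubC /= => bbs.
have [bR b2] := bsP bbs; have := al_gt1.
rewrite -(gtr0_norm al_gt0) (unit_circle_trace al_neq0) ?alE //.
by rewrite ltxx.
Qed.

Lemma salem_of_trace : bs != [::] ->
  salem al /\ alg_degree al = (2 * (size bs).+1)%N.
Proof.
move=> bs0; rewrite /salem /alg_degree /conjugate minCpoly_salem size_S.
split=> //; have [alA _] := salem_Aint; split=> //.
- by rewrite gtr0_real.
- move=> x /rootS_norm/or3P[-> //|/eqP -> _|/eqP -> //].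
  by rewrite normfV gtr0_norm // invf_le1 // ltW.
(* Any trace [c] in [bs] provides the conjugate on the unit circle. *)
case: (bs) bs0 bsP rootS => // c s _ /(_ c (mem_head _ _))[cR c2].
have /closed_rootP[x] : size ('X^2 - c *: 'X + 1 : {poly algC}) != 1 by rewrite quad_size.
rewrite rootE !hornerE /= => /eqP xE.
have x0 : x != 0.
  by apply: contra_eq_neq xE => ->; rewrite expr0n mulr0 subr0 add0r oner_eq0.
have xc : x + x^-1 = c.
  apply: (mulfI x0); apply/eqP; rewrite -subr_eq0 -xE; apply/eqP; field.
  by rewrite x0.
move=> rootSE; exists x; last by rewrite (unit_circle_trace x0) ?xc.
rewrite rootSE.
by rewrite x0 xc !inE eqxx orbT.
Qed.

End SalemTrace.

(** * Trace polynomials of roots of unity *)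

(** The Chebyshev recurrence in the variable [x + x^-1]. The initial terms are parameters because
    they select the family. *)
Fixpoint chebyshev (p0 p1 : {poly algC}) (k : nat) : {poly algC} :=
  if k is k'.+1 then chebyshev p1 ('X * p1 - p0) k' else p0.

Lemma chebyshev_monic e k p0 p1 :
    p0 \is monic -> size p0 = e.+1 -> p1 \is monic -> size p1 = e.+2 ->
  chebyshev p0 p1 k \is monic /\ size (chebyshev p0 p1 k) = (e + k).+1.
Proof.
elim: k => [|k IHk] in e p0 p1 *; first by rewrite addn0.
move=> m0 s0 m1 s1 /=; rewrite addnS -addSn; apply: IHk => //.
  rewrite monicE lead_coefDl ?lead_coefM ?lead_coefX ?mul1r //.
  by rewrite size_polyN mulrC size_mulX ?monic_neq0 // s0 s1.
by rewrite size_polyDl ?size_polyN mulrC size_mulX ?monic_neq0 // s1 // s0.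
Qed.

Lemma chebyshev_polyOver (S : subringClosed algC) k p0 p1 :
  p0 \is a polyOver S -> p1 \is a polyOver S -> chebyshev p0 p1 k \is a polyOver S.
Proof.
elim: k p0 p1 => //= k IHk p0 p1 S0 S1; apply: IHk => //.
by rewrite rpredB ?rpredM ?polyOverX.
Qed.

(** At the trace of [x], the characteristic roots of the recurrence are [x] and [x^-1]. *)
Lemma chebyshev_eval k p0 p1 x a b : x != 0 ->
    p0.[x + x^-1] = a + b -> p1.[x + x^-1] = a * x + b * x^-1 ->
  (chebyshev p0 p1 k).[x + x^-1] = a * x ^+ k + b * x ^- k.
Proof.
move=> x0; elim: k => [|k IHk] in p0 p1 a b *; first by rewrite invr1 !mulr1.
move=> e0 e1 /=; rewrite (IHk _ _ (a * x) (b * x^-1)) //.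
  by rewrite !exprS invfM; ring.
by rewrite !hornerE /= e0 e1; field.
Qed.

Lemma oner_neqN1 : 1 != -1 :> algC.
Proof. by rewrite -addr_eq0 (pnatr_eq0 _ 2). Qed.

(* [ws] contains both [w] and [w^-1] for each root [w + w^-1] of [q]. *)
Definition circle_trace (d : nat) q (ws : seq algC) :=
  [/\ q \is monic, size q = d.+1, forall S : subringClosed algC, q \is a polyOver S,
      uniq ws && (size ws == d.*2) &
      {in ws, forall w : algC, [/\ `|w| = 1, w ^+ 2 != 1 & root q (w + w^-1)]}].

Lemma circle_trace1 : circle_trace 0 1 [::].
Proof. by split=> //; rewrite ?monic1 ?size_poly1 // => S; rewrite rpred1. Qed.

Lemma circle_traceM d1 d2 q1 q2 ws1 ws2 :
    circle_trace d1 q1 ws1 -> circle_trace d2 q2 ws2 ->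
    {in ws1, forall w : algC, w \notin ws2} ->
  circle_trace (d1 + d2) (q1 * q2) (ws1 ++ ws2).
Proof.
case=> m1 s1 S1 /andP[u1 /eqP z1] r1 [m2 s2 S2 /andP[u2 /eqP z2] r2] dis.
split; [| | move=> S | | move=> w].
- by rewrite monicMl.
- by rewrite size_monicM ?monic_neq0 // s1 s2 addnS.
- by rewrite rpredM ?S1 ?S2.
- rewrite cat_uniq u1 u2 size_cat z1 z2 doubleD eqxx !andbT /=.
  by apply/hasPn => w w2; apply/negP => /dis; rewrite w2.
rewrite mem_cat => /orP[/r1|/r2] [-> -> rw]; split=> //.
  by rewrite rootM rw.
by rewrite rootM rw orbT.
Qed.

(** The derivative of ['X^N - a] can vanish only at 0, which is not a root. *)
Lemma uniq_roots_exist N a : (0 < N)%N -> a != 0 ->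
  exists ws, [/\ uniq ws, size ws = N & forall w : algC, (w \in ws) = (w ^+ N == a)].
Proof.
move=> N0 a0; pose p : {poly algC} := 'X^N - a%:P.
have p_mon : p \is monic by rewrite monicXnsubC.
have [ws pE] := closed_field_poly_normal p.
rewrite (monicP p_mon) scale1r in pE.
have wsE w : (w \in ws) = (w ^+ N == a).
  by rewrite -root_prod_XsubC -pE rootE !hornerE subr_eq0.
exists ws; split=> //; last first.
  by have := size_prod_XsubC ws id; rewrite -pE size_XnsubC // => -[].
rewrite -separable_prod_XsubC -pE unlock.
apply/Pdiv.ClosedField.coprimepP => w.
rewrite rootE !hornerE subr_eq0 => wN.
have w0 : w != 0.
  by apply: contraTneq wN => ->; rewrite expr0n gtn_eqF // eq_sym.
rewrite !derivE subr0 hornerMn !hornerE -mulr_natr mulf_neq0 ?expf_neq0 //.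
by rewrite pnatr_eq0 -lt0n.
Qed.

Lemma norm1_unity N (w : algC) : (0 < N)%N -> `|w ^+ N| = 1 -> `|w| = 1.
Proof.
by move=> N0 wN; apply/eqP; rewrite -(@pexpr_eq1 _ _ N) // -normrX wN.
Qed.

(** Here [q] is the sum of the [x ^ i] for [-m <= i <= m], written in the trace. *)
Lemma circle_trace_V m : exists q ws,
  [/\ circle_trace m q ws, {in ws, forall w : algC, w ^+ m.*2.+1 = 1} &
      forall x, x != 0 -> (x - 1) * (x ^+ m * q.[x + x^-1]) = x ^+ m.*2.+1 - 1].
Proof.
have [//||ws0 [u0 s0 ws0E]] := @uniq_roots_exist m.*2.+1 1; rewrite ?oner_neq0 //.
pose q := chebyshev 1 ('X + 1) m.
have qE x : x != 0 -> (x - 1) * (x ^+ m * q.[x + x^-1]) = x ^+ m.*2.+1 - 1.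
  move=> x0; have [->|x1] := eqVneq x 1; first by rewrite !expr1n !subrr mul0r.
  rewrite -subr_eq0 in x1.
  (* The coefficients solve [a + b = 1] and [a * x + b * x^-1 = x + x^-1 + 1]. *)
  rewrite (@chebyshev_eval _ _ _ _ (x / (x - 1)) (- (x - 1)^-1)) //.
  - rewrite exprS -addnn exprD; field.
    by rewrite x1 expf_neq0.
  - by rewrite hornerE; field.
  - by rewrite !hornerE; field; rewrite x0.
have in_ws w : w \in rem 1 ws0 -> w != 1 /\ w ^+ m.*2.+1 = 1.
  by rewrite mem_rem_uniq // inE => /andP[w1]; rewrite ws0E => /eqP.
exists q, (rem 1 ws0); split=> //; last by move=> w /in_ws[].
have [q_mon q_size] : q \is monic /\ size q = (0 + m).+1.
  apply: chebyshev_monic; rewrite ?monic1 ?size_poly1 //.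
    by rewrite -['X + 1]/('X + 1%:P) monicXaddC.
  by rewrite -['X + 1]/('X + 1%:P) size_XaddC.
split=> //.
- by move=> S; rewrite chebyshev_polyOver ?rpredD ?rpred1 ?polyOverX.
- by rewrite rem_uniq // size_rem ?s0 ?ws0E ?expr1n //=.
move=> w /in_ws[w1 wm]; have w0 : w != 0.
  by apply: contra_eq_neq wm => ->; rewrite expr0n /= eq_sym oner_eq0.
split.
- by apply: (@norm1_unity m.*2.+1); rewrite // wm normr1.
- by apply: contra w1 => /eqP w2; rewrite -wm exprS -mul2n exprM w2 expr1n mulr1.
have := qE w w0; rewrite wm subrr => /eqP; rewrite mulf_eq0 subr_eq0 (negPf w1) /=.
by rewrite mulf_eq0 expf_eq0 (negPf w0) andbF.
Qed.

(** The even analogue: both 1 and -1 are removed from the roots of unity, and [q] is the sum of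
    [x ^ m], [x ^ (m - 2)], and so on down to [x ^ (- m)]. *)
Lemma circle_trace_U m : exists q ws,
  [/\ circle_trace m q ws, {in ws, forall w : algC, w ^+ m.*2.+2 = 1} &
      forall x, x != 0 ->
        (x ^+ 2 - 1) * (x ^+ m * q.[x + x^-1]) = x ^+ m.*2.+2 - 1].
Proof.
have [//||ws0 [u0 s0 ws0E]] := @uniq_roots_exist m.*2.+2 1; rewrite ?oner_neq0 //.
pose q := chebyshev 1 'X m.
have qE x : x != 0 -> (x ^+ 2 - 1) * (x ^+ m * q.[x + x^-1]) = x ^+ m.*2.+2 - 1.
  move=> x0; have [x1|x1] := eqVneq (x ^+ 2) 1.
    by rewrite -[m.*2.+2]/(m.+1.*2) -mul2n exprM x1 expr1n !subrr mul0r.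
  rewrite -subr_eq0 in x1.
  rewrite (@chebyshev_eval _ _ _ _ (x ^+ 2 / (x ^+ 2 - 1)) (- (x ^+ 2 - 1)^-1)) //.
  - rewrite !exprS -addnn exprD; field.
    by rewrite x1 expf_neq0.
  - by rewrite hornerE; field.
  - by rewrite hornerX; field; rewrite x0.
have in_ws w : w \in rem (-1) (rem 1 ws0) -> w ^+ 2 != 1 /\ w ^+ m.*2.+2 = 1.
  rewrite mem_rem_uniq ?rem_uniq // inE mem_rem_uniq // inE => /and3P[wN1 w1].
  by rewrite ws0E => /eqP ->; rewrite sqrf_eq1 negb_or w1.
exists q, (rem (-1) (rem 1 ws0)); split=> //; last by move=> w /in_ws[].
have [q_mon q_size] : q \is monic /\ size q = (0 + m).+1.
  by apply: chebyshev_monic; rewrite ?monic1 ?size_poly1 ?monicX ?size_polyX.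
split=> //.
- by move=> S; rewrite chebyshev_polyOver ?rpred1 ?polyOverX.
- rewrite !rem_uniq // !size_rem ?s0 ?ws0E ?expr1n //=.
  rewrite mem_rem_uniq // inE ws0E -signr_odd /= negbK odd_double eqxx andbT.
  by rewrite eq_sym oner_neqN1.
move=> w /in_ws[w1 wm]; have w0 : w != 0.
  by apply: contra_eq_neq wm => ->; rewrite expr0n /= eq_sym oner_eq0.
split=> //; first by apply: (@norm1_unity m.*2.+2); rewrite // wm normr1.
have := qE w w0; rewrite wm subrr => /eqP; rewrite mulf_eq0 subr_eq0 (negPf w1) /=.
by rewrite mulf_eq0 expf_eq0 (negPf w0) andbF.
Qed.

(* For [k = 0], [q] is 1 and not the Chebyshev polynomial 2, which is not
   monic. *)
Lemma circle_trace_T k : exists q ws,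
  circle_trace k q ws /\ {in ws, forall w : algC, w ^+ k.*2 = -1}.
Proof.
case: k => [|k]; first by exists 1, [::]; split=> //; apply: circle_trace1.
have [||ws [u s wsE]] := @uniq_roots_exist k.+1.*2 (-1); rewrite ?oppr_eq0 ?oner_neq0 //.
pose q := chebyshev 'X ('X^2 - 2%:P) k.
exists q, ws; split; last by move=> w; rewrite wsE => /eqP.
have [q_mon q_size] : q \is monic /\ size q = (1 + k).+1.
  by apply: chebyshev_monic; rewrite ?monicX ?size_polyX ?monicXnsubC ?size_XnsubC.
split=> //.
- move=> S; rewrite chebyshev_polyOver ?rpredB ?rpredX ?polyOverX //.
  by rewrite polyOverC rpredMn ?rpred1.
- by rewrite u s eqxx.
move=> w; rewrite wsE => /eqP wk.
have w0 : w != 0.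
  by apply: contra_eq_neq wk => ->; rewrite expr0n /= eq_sym oppr_eq0 oner_eq0.
split.
- by apply: (@norm1_unity k.+1.*2); rewrite // wk normrN1.
- apply: contra_eq_neq wk => w2; rewrite -mul2n exprM w2 expr1n.
  exact: oner_neqN1.
(* The value is [w ^+ k.+1 + w ^- k.+1], which vanishes because [w ^+ k.+1.*2 = -1]. *)
rewrite rootE (@chebyshev_eval _ _ _ _ w w^-1) ?hornerE //; last by field.
rewrite -invfM -!exprS addr_eq0 -[X in _ == X]mulN1r -wk -addnn exprD mulfK //.
by rewrite expf_neq0.
Qed.

(** * Salem numbers *)

(** Two numbers with the same trace are equal or inverse. So each [w] is the chosen preimage [z r]
    of its trace or the inverse of [z r], and [L] lists all of these. *)
Lemma size_undup_traces (ws : seq algC) : uniq ws -> 0 \notin ws ->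
  (size ws <= (size (undup [seq (w + w^-1)%R | w <- ws])).*2)%N.
Proof.
set tr := fun w : algC => w + w^-1; rewrite -/tr => ws_uniq ws0.
pose z r := nth 0 ws (index r (map tr ws)).
have zE r : r \in map tr ws -> z r \in ws /\ tr (z r) = r.
  move=> rws; have lt : (index r (map tr ws) < size ws)%N.
    by rewrite -(size_map tr) index_mem.
  by rewrite mem_nth // -(nth_map 0 0) ?nth_index.
pose L := [seq (if e then z r else (z r)^-1)
              | r <- undup (map tr ws), e <- [:: true; false]].
have -> : (size (undup (map tr ws))).*2 = size L by rewrite size_allpairs muln2.
apply: uniq_leq_size => // w wws; apply/allpairsP.
have rws : tr w \in map tr ws by apply: map_f.
have [zws zw] := zE _ rws.
have w0 : w != 0 by apply: contraNneq ws0 => <-.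
have z0 : z (tr w) != 0 by apply: contraNneq ws0 => <-.
have : (w - z (tr w)) * (w - (z (tr w))^-1) = w * (tr w - tr (z (tr w))).
  by rewrite /(tr w) /(tr (z _)); field; rewrite w0 z0.
rewrite zw subrr mulr0 => /eqP; rewrite mulf_eq0 !subr_eq0 => /orP[]/eqP wE.
  by exists (tr w, true); rewrite mem_undup.
by exists (tr w, false); rewrite mem_undup.
Qed.

Lemma circle_trace_bound (w : algC) : `|w| = 1 -> w ^+ 2 != 1 ->
  [/\ w + w^-1 \is Num.real, -2 <= w + w^-1 <= 2, w + w^-1 != 2 & w + w^-1 != -2].
Proof.
move=> w1 w2; have w0 : w != 0 by rewrite -normr_eq0 w1 oner_eq0.
have wV : w^-1 = w^*.
  by apply: (mulfI w0); rewrite divff // -normCK w1 expr1n.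
have wR : w + w^-1 \is Num.real.
  by apply/CrealP; rewrite rmorphD /= wV conjCK addrC.
split=> //.
- rewrite -real_ler_norml // (le_trans (ler_normD _ _)) // normfV w1 invr1.
  exact: lexx.
- apply: contra w2 => /eqP we.
  have : (w - 1) ^+ 2 = w * (w + w^-1 - 2) by field.
  rewrite we subrr mulr0 => /eqP; rewrite expf_eq0 subr_eq0 /= => /eqP->.
  by rewrite expr1n.
- apply: contra w2 => /eqP we.
  have : (w + 1) ^+ 2 = w * (w + w^-1 + 2) by field.
  rewrite we addNr mulr0 => /eqP; rewrite expf_eq0 addr_eq0 /= => /eqP->.
  by rewrite sqrrN expr1n.
Qed.

(** The [d.*2] elements of [ws] have at least [d] distinct traces, which exhaust the roots of
    [q]. *)
Lemma circle_trace_split d q ws : circle_trace d q ws ->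
  exists s, [/\ q = \prod_(r <- s) ('X - r%:P), uniq s, size s = d &
    {in s, forall r : algC, [/\ r \is Num.real, -2 <= r <= 2, r != 2 & r != -2]}].
Proof.
case=> q_mon q_size _ /andP[ws_uniq /eqP ws_size] wsP.
pose s := undup [seq w + w^-1 | w <- ws].
have s_uniq : uniq s by apply: undup_uniq.
have ws0 : 0 \notin ws.
  by apply/negP => /wsP[]; rewrite normr0 => /eqP; rewrite eq_sym oner_eq0.
have sP r : r \in s -> exists2 w, w \in ws & r = w + w^-1.
  by rewrite mem_undup => /mapP.
have s_roots : all (root q) s by apply/allP => _ /sP[w /wsP[_ _ rw] ->].
have s_size : size s = d.
  apply/eqP; rewrite eqn_leq -ltnS -q_size max_poly_roots ?monic_neq0 //=.
  by rewrite -leq_double -ws_size size_undup_traces.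
exists s; split=> //; last first.
  by move=> _ /sP[w /wsP[w1 w2 _] ->]; apply: circle_trace_bound.
rewrite [LHS](@all_roots_prod_XsubC _ _ s) ?uniq_rootsE ?s_size //.
by rewrite (monicP q_mon) scale1r.
Qed.

(** The larger root of [x ^+ 2 - b * x + 1]. The last bound makes [x] grow with [b], hence gives
    infinitely many Salem numbers. *)
Lemma ex_add_inv (F : rcfType) (b : F) :
  2 < b -> exists x : F, [/\ 1 < x, x + x^-1 = b & b < x + 1].
Proof.
move=> b2; pose d := Num.sqrt (b ^+ 2 - 4).
have d_ge0 : 0 <= d by apply: sqrtr_ge0.
have dE : d ^+ 2 = b ^+ 2 - 4 by rewrite sqr_sqrtr //; nra.
have x1 : 1 < (b + d) / 2 by lra.
have x0 : (b + d) / 2 != 0 by apply: lt0r_neq0; lra.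
suff xE : (b + d) / 2 + ((b + d) / 2)^-1 = b.
  exists ((b + d) / 2); split=> //.
  by rewrite -[ltLHS]xE ltrD2l invf_lt1 // (lt_trans ltr01).
apply: (mulfI x0); rewrite mulrDr divff //.
have -> : (b + d) / 2 * ((b + d) / 2) = (b ^+ 2 + 2 * b * d + d ^+ 2) / 4 by field.
by rewrite dE; field.
Qed.

Lemma unbounded_infinite (A : set algC) :
  (forall m : nat, exists2 x, A x & m%:R < x) -> infinite_set A.
Proof.
move=> Aunb /finite_seqP[s sE].
have [x] := Aunb (Num.bound (\sum_(y <- s) `|y|)).
set M := \sum_(y <- s) _; rewrite sE /= => xs ltMx.
have M0 : 0 <= M by rewrite sumr_ge0.
have xM : `|x| <= M by rewrite /M (big_rem x) //= lerDl sumr_ge0.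
have xR : x \is Num.real by rewrite gtr0_real // (le_lt_trans _ ltMx) ?ler0n.
have := lt_trans (archi_boundP M0) (lt_le_trans ltMx (real_ler_norm xR)).
by move/lt_le_trans/(_ xM); rewrite ltxx.
Qed.

(** The last hypothesis says that [x ^+ n - 1] divides [Q.[x + x^-1]] up to a power of [x]. It is
    asked of every unit [x] because the Salem number depends on [a]. *)
Lemma infinite_salem (n : nat) (Q : {poly algC}) (s : seq algC) :
    Q = \prod_(r <- s) ('X - r%:P) ->
    (forall S : subringClosed algC, Q \is a polyOver S) ->
    uniq s -> {in s, forall r, r \is Num.real /\ -2 <= r <= 2} ->
    2 \in s -> (-2 \in s -> ~~ odd (size s)) ->
    (forall x, x != 0 -> x \in Aint -> x^-1 \in Aint -> exists2 k, k \in Aint &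
        exists N, (x ^+ n - 1) * k = x ^+ N * Q.[x + x^-1]) ->
  infinite_set
    [set a : algC | [/\ salem a, alg_degree a = (2 * (size s).+1)%N
                      & alg_unit (a ^+ n - 1)%R]]%classic.
Proof.
move=> QE QS s_uniq s_bnd s2 sN2 Qunit; apply: unbounded_infinite => m.
(* [perturbed_roots] needs a real closed field. All roots are real, so the default 0 never
   occurs. *)
pose s' : seq algR := map (insubd 0) s.
have s'E : map algRval s' = s.
  rewrite -map_comp map_id_in // => r /s_bnd[rR _] /=.
  by rewrite [LHS](insubdK (0 : algR)).
have mem_s' r : (r \in s') = (algRval r \in s).
  by rewrite -s'E mem_map //; exact: val_inj.
have [||||A AP] := @perturbed_roots algR s'.
- by rewrite -(map_inj_uniq val_inj) s'E.
- by move=> r; rewrite mem_s' => /s_bnd[_].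
- by rewrite mem_s' rmorph_nat.
- by rewrite mem_s' rmorphN rmorph_nat size_map.
(* The three summands serve the perturbation bound, the unboundedness of the Salem numbers and
   [3 <= a]. *)
pose N := (Num.bound `|A| + m + 3)%N.
have leAN : A <= N%:R.
  rewrite (le_trans (ler_norm A)) // ltW //.
  rewrite (lt_le_trans (archi_boundP (normr_ge0 _))) //.
  by rewrite ler_nat /N -addnA leq_addr.
have [bs [b [RE bs_size bs_bnd _ ltNb]]] := AP _ leAN.
have N3 : (3 : algR) <= N%:R by rewrite ler_nat leq_addl.
have [|x [x1 xE bx]] := @ex_add_inv algR b.
  by apply: lt_trans ltNb; apply: lt_le_trans N3; rewrite ltr_nat.
have xm : m%:R < x.
  rewrite -(ltrD2r 1); apply: le_lt_trans (lt_trans ltNb bx).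
  by rewrite natr1 ler_nat /N; lia.
pose a : algC := N%:R; pose al := algRval x.
have al1 : 1 < al := x1.
have alE : al + al^-1 = algRval b by rewrite -xE.
have al0 : al != 0 by rewrite gt_eqF // (lt_trans ltr01).
have RE' : Q * ('X - a%:P) - 1 =
    ('X - (algRval b)%:P) * \prod_(c <- map algRval bs) ('X - c%:P).
  have := congr1 (map_poly algRval) RE.
  rewrite !(rmorphB, rmorphM) /= rmorph1 !map_polyX !map_polyC /= rmorph_nat.
  rewrite -/a !rmorph_prod /= big_map QE -s'E big_map.
  under eq_bigr do rewrite rmorphB /= map_polyX map_polyC.
  move=> ->; congr (_ * _).
  by apply: eq_bigr => c _; rewrite rmorphB /= map_polyX map_polyC.
have bsP : {in map algRval bs, forall c, c \is Num.real /\ `|c| < 2}.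
  move=> _ /mapP[c cbs ->]; have /andP[c1 c2] := bs_bnd _ cbs.
  split; first exact: algRvalP.
  by rewrite real_ltr_norml ?algRvalP //; apply/andP; split.
have aC : a \in Crat by rewrite rpred_nat.
have aA : a \in Aint by rewrite rpred_nat.
have a3 : 3 <= `|a| by rewrite normr_nat ler_nat leq_addl.
have [alA alVA] := salem_Aint (QS Crat) (QS Aint) aC aA RE' al1 alE.
have [|al_salem al_deg] := salem_of_trace (QS Crat) (QS Aint) aC aA a3 RE' bsP al1 alE.
  by rewrite -size_eq0 size_map bs_size size_map size_eq0; apply: contraTneq s2 => ->.
have al_gtm : m%:R < al by rewrite -(rmorph_nat algRval); exact: xm.
exists al; last exact: al_gtm.
split=> //.
  by rewrite al_deg size_map bs_size size_map.
have Qb : Q.[al + al^-1] * (al + al^-1 - a) = 1.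
  have := congr1 (horner^~ (algRval b)) RE'.
  rewrite hornerM hornerXsubC subrr mul0r !hornerE alE => /eqP.
  by rewrite subr_eq0 => /eqP.
have [k kA [M kE]] := Qunit _ al0 alA alVA.
have uE : (al ^+ n - 1) * (k * al^-1 ^+ M * (al + al^-1 - a)) = 1.
  rewrite !mulrA kE -Qb exprVn; field.
  by rewrite al0 expf_neq0.
have u0 : al ^+ n - 1 != 0.
  by apply: contra_eq_neq uE => ->; rewrite mul0r eq_sym oner_eq0.
have uV : (al ^+ n - 1)^-1 = k * al^-1 ^+ M * (al + al^-1 - a).
  by apply: (mulfI u0); rewrite uE divff.
split=> //; rewrite ?uV; first by rewrite rpredB ?rpredX ?rpred1.
by rewrite !rpredM ?rpredB ?rpredD ?rpredX.
Qed.

(** * Choice of the trace polynomial *)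

Lemma real_bound2 : (2 : algC) \is Num.real /\ -2 <= (2 : algC) <= 2.
Proof. by rewrite rpred_nat lexx (le_trans _ (ler0n _ 2)) ?oppr_le0 ?ler0n. Qed.

Lemma real_boundN2 : (-2 : algC) \is Num.real /\ -2 <= (-2 : algC) <= 2.
Proof. by have [? /andP[H _]] := real_bound2; rewrite rpredN H lexx. Qed.

Lemma neq2N2 : (2 : algC) != -2.
Proof. by rewrite -addr_eq0 -natrD pnatr_eq0. Qed.

Lemma infinite_salem_odd m d q1 q2 ws :
    circle_trace d (q1 * q2) ws ->
    (forall S : subringClosed algC, q2 \is a polyOver S) ->
    (forall x, x != 0 -> (x - 1) * (x ^+ m * q1.[x + x^-1]) = x ^+ m.*2.+1 - 1) ->
  infinite_set
    [set a : algC | [/\ salem a, alg_degree a = (2 * d.+2)%N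
                      & alg_unit (a ^+ m.*2.+1 - 1)%R]]%classic.
Proof.
move=> qT q2S q1E; have [_ _ qS _ _] := qT.
have [s [qE s_uniq s_size sP]] := circle_trace_split qT.
have := @infinite_salem m.*2.+1 (('X - 2%:P) * (q1 * q2)) (2 :: s).
rewrite /= s_size; apply.
- by rewrite big_cons qE.
- by move=> S; rewrite rpredM ?polyOverXsubC ?rpred_nat ?qS.
- by rewrite s_uniq andbT; apply/negP => /sP[_ _]; rewrite eqxx.
- by move=> r; rewrite inE => /predU1P[->|/sP[-> ->] //]; apply: real_bound2.
- exact: mem_head.
- rewrite inE eq_sym (negPf neq2N2) => /sP[_ _ _].
  by rewrite eqxx.
(* [x * (x + x^-1 - 2) = (x - 1) ^+ 2]: one factor completes [x ^+ n - 1], the other goes into the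
   cofactor. *)
move=> x x0 xA xVA; exists ((x - 1) * q2.[x + x^-1]).
  by rewrite rpredM ?rpredB ?rpred1 // rpred_horner ?rpredD ?q2S.
exists m.+1; rewrite -q1E // !hornerM hornerXsubC exprS.
set v1 := q1.[_]; set v2 := q2.[_]; set y := x ^+ m.
by field.
Qed.

Lemma infinite_salem_even m d q1 q2 ws : ~~ odd d ->
    circle_trace d (q1 * q2) ws ->
    (forall S : subringClosed algC, q2 \is a polyOver S) ->
    (forall x, x != 0 ->
      (x ^+ 2 - 1) * (x ^+ m * q1.[x + x^-1]) = x ^+ m.*2.+2 - 1) ->
  infinite_set
    [set a : algC | [/\ salem a, alg_degree a = (2 * d.+3)%N
                      & alg_unit (a ^+ m.*2.+2 - 1)%R]]%classic.
Proof.
move=> d_even qT q2S q1E; have [_ _ qS _ _] := qT.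
have [s [qE s_uniq s_size sP]] := circle_trace_split qT.
have := @infinite_salem m.*2.+2
  (('X - 2%:P) * (('X - (-2)%:P) * (q1 * q2))) (2 :: -2 :: s).
rewrite /= s_size; apply.
- by rewrite !big_cons qE.
- move=> S; move: (q1 * q2) (qS S) => q qSS.
  by rewrite !rpredM ?polyOverXsubC ?rpredN ?rpred_nat.
- rewrite s_uniq andbT inE (negPf neq2N2).
  by apply/andP; split; apply/negP => /sP[_ _]; rewrite eqxx.
- move=> r; rewrite !inE => /or3P[/eqP->|/eqP->|/sP[-> ->] //].
    exact: real_bound2.
  exact: real_boundN2.
- exact: mem_head.
(* As -2 is now a root, [d + 2] has to be even. *)
- by rewrite /= negbK.
(* The roots 2 and -2 together give [(x ^+ 2 - 1) ^+ 2], half of which completes [x ^+ n - 1]. *)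
move=> x x0 xA xVA; exists ((x ^+ 2 - 1) * q2.[x + x^-1]).
  by rewrite rpredM ?rpredB ?rpredX ?rpred1 // rpred_horner ?rpredD ?q2S.
exists m.+2; rewrite -q1E // !hornerM !hornerXsubC !exprS.
set v1 := q1.[_]; set v2 := q2.[_]; set y := x ^+ m.
by field.
Qed.

(** The same power of [w] would be both 1 and -1; this separates roots of unity of different
    kinds. *)
Lemma sign_coprime (w : algC) i j k l : w ^+ i = 1 -> w ^+ j = -1 -> odd k ->
  (i * l)%N = (j * k)%N -> False.
Proof.
move=> wi wj k_odd eq_ij; have : (w ^+ i) ^+ l = (w ^+ j) ^+ k.
  by rewrite -!exprM eq_ij.
rewrite wi wj expr1n -signr_odd k_odd expr1 => /eqP.
by rewrite (negPf oner_neqN1).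
Qed.

Lemma unity_coprime (w : algC) i j :
  w ^+ i = 1 -> w ^+ j = 1 -> coprime i j -> w = 1.
Proof.
move=> /eqP + /eqP; rewrite -!dvdn_orderC => wi wj /eqP co.
have : (#[w]%C %| gcdn i j)%N by rewrite dvdn_gcd wi.
by rewrite co dvdn_orderC expr1 => /eqP.
Qed.

Theorem theorem1 (n t : nat) (hn : (1 <= n)%N) (ht : (2 <= t)%N)
  (hcond :
    [\/ odd n /\ (n + 3 <= 2 * t)%N,
        [/\ n = 2 %[mod 4], odd t & (n + 4 <= 2 * t)%N],
        [/\ exists2 s : nat, (2 <= s)%N & n = (2 ^ s)%N,
            odd t & (n + 6 <= 2 * t)%N]
      | [/\ n = 4 %[mod 8], n <> 0 %[mod 3], odd t & (n + 6 <= 2 * t)%N]]) :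
  infinite_set
    [set a : algC | [/\ salem a, alg_degree a = (2 * t)%N
                      & alg_unit (a ^+ n - 1)%R]]%classic.
Proof.
have polyS d q ws :
    circle_trace d q ws -> forall S : subringClosed algC, q \is a polyOver S.
  by case.
have [n_odd|n_even] := boolP (odd n).
  have [m nE] : exists m, n = m.*2.+1.
    by exists n./2; rewrite -[LHS]odd_double_half n_odd.
  (* The remaining degree [k] is filled by roots of [w ^+ k.*2 = -1], none of which is an [n]-th
     root of unity as [n] is odd. *)
  have [k tE] : exists k, t = (m + k).+2.
    exists (t - m.+2)%N; case: hcond => [[_]|[]|[[s s2 ns]]|[]]; lia.
  rewrite {}nE {}tE in hcond *.
  have [q1 [ws1 [q1T ws1E q1E]]] := circle_trace_V m.
  have [q2 [ws2 [q2T ws2E]]] := circle_trace_T k.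
  apply: (infinite_salem_odd (circle_traceM q1T q2T _) (polyS _ _ _ q2T) q1E).
  move=> w /ws1E w1; apply/negP => /ws2E w2.
  by apply: (sign_coprime (k := m.*2.+1) w1 w2 _ (mulnC _ _)); rewrite /= odd_double.
have [m nE] : exists m, n = m.*2.+2.
  exists n./2.-1; have := odd_double_half n; rewrite (negPf n_even); lia.
have t_odd : odd t by case: hcond => [[]|[]|[]|[]]; rewrite ?(negPf n_even).
(* With 2 and -2 among the roots, the remaining degree is [t - m - 3], to be filled avoiding the
   [n]-th roots of unity. *)
have [d [q2 [ws2 [q2T wsD tE]]]] : exists d q2 ws2,
  [/\ circle_trace d q2 ws2, {in ws2, forall w : algC, w ^+ n != 1} & t = (m + d).+3].
  have unity_neq1 d q ws w : circle_trace d q ws -> w \in ws -> w != 1.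
    by case=> _ _ _ _ wsP /wsP[_ w2 _]; apply: contraNneq w2 => ->; rewrite expr1n.
  case: hcond => [[n_odd]|[n2 _ tn]|[[s s2 ns] _ tn]|[n4 n3 _ tn]].
  - by rewrite n_odd in n_even.
  (* Here [n = 2 * m.+1] with [m.+1] odd, so [w ^+ n = 1] and [w ^+ d.*2 = -1] are incompatible. *)
  - have [d [d_even tE]] : exists d, ~~ odd d /\ t = (m + d).+3.
      by exists (t - m.+3)%N; split; lia.
    have [q2 [ws2 [q2T ws2E]]] := circle_trace_T d.
    exists d, q2, ws2; split=> // w /ws2E wE; apply/eqP => wn.
    by apply: (sign_coprime (k := m.+1) (l := d) wn wE); lia.
  (* Now [d] is odd and [w ^+ d.*2 = -1] would admit the fourth roots of unity ['i] and [-'i]. Roots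
     of odd order [d.*2.+1] are taken instead, this order being prime to [2 ^ s]. *)
  - have [d tE] : exists d, t = (m + d).+3 by exists (t - m.+3)%N; lia.
    have [q2 [ws2 [q2T ws2E q2E]]] := circle_trace_V d.
    exists d, q2, ws2; split=> // w wws; apply/eqP => wn.
    have := unity_neq1 _ _ _ _ q2T wws; rewrite (unity_coprime wn (ws2E _ wws)) ?eqxx //.
    by rewrite ns coprimeXl // coprime2n /= odd_double.
  (* The remaining degree is again odd. The primitive cube roots of unity, excluded from the [n]-th
     roots by [n <> 0 %[mod 3]], take up one degree and leave an even [d]. *)
  have [d [d_even tE]] : exists d, ~~ odd d /\ t = (m + d.+1).+3.
    by exists (t - m.+4)%N; split; lia.
  have [q2 [ws2 [q2T ws2E _]]] := circle_trace_V 1.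
  have [q3 [ws3 [q3T ws3E]]] := circle_trace_T d.
  exists d.+1, (q2 * q3), (ws2 ++ ws3); split=> //.
    rewrite -add1n; apply: circle_traceM => // w /ws2E w2; apply/negP => /ws3E w3.
    by apply: (sign_coprime (k := 3) w2 w3 _ (mulnC _ _)).
  move=> w; rewrite mem_cat => /orP[w2|/ws3E w3]; apply/eqP => wn.
    have := unity_neq1 _ _ _ _ q2T w2; rewrite (unity_coprime wn (ws2E _ w2)) ?eqxx //.
    by rewrite coprime_sym prime_coprime // /dvdn; apply/eqP.
  (* With [n = 4 * p], [p] odd, the exponents agree: [n * e = d.*2 * p]. *)
  have [e dE] : exists e, d = (2 * e)%N by exists d./2; lia.
  have [p [nE4 p_odd]] : exists p : nat, n = (4 * p)%N /\ odd p.
    by exists (n %/ 4)%N; split; lia.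
  by apply: (sign_coprime (k := p) (l := e) wn w3); lia.
have [q1 [ws1 [q1T ws1E q1E]]] := circle_trace_U m.
rewrite nE tE.
apply: (infinite_salem_even _ (circle_traceM q1T q2T _) (polyS _ _ _ q2T) q1E).
  by move: t_odd; rewrite tE /= negbK.
move=> w /ws1E w1; apply/negP => /wsD.
by rewrite nE w1 eqxx.
Qed.
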